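(* Let $K\ge3$, $N\ge2$, $\theta>0$, $p>0$, and let $\nu_N$ be the stationary distribution of the $N$-particle process on $\mathcal{E}_{K,N}$ with generator $\mathcal{L}_{K,N}$. The covariance under $\nu_N$ between the proportions of particles at two sites is decreasing (in the non-strict sense) as a function of the graph distance in the cycle between these sites, i.e. for all $k=0,1,\dots,\lfloor K/2\rfloor-1$, \[ \operatorname{Cov}_{\nu_N}\left[\frac{\eta(0)}{N},\frac{\eta(k)}{N}\right]\ge\operatorname{Cov}_{\nu_N}\left[\frac{\eta(0)}{N},\frac{\eta(k+1)}{N}\right]. \]
   Context: $\mathcal{E}_{K,N}=\{\eta:\mathbb{Z}/K\mathbb{Z}\to\mathbb{N},\ \sum_{k}\eta(k)=N\}$ ($\mathbb{N}$ includes $0$). The generator is \[ (\mathcal{L}_{K,N}f)(\eta)=\sum_{i,j\in\mathbb{Z}/K\mathbb{Z}}\eta(i)\left(\mathbf{1}_{\{j=i+1\}}+\theta\,\mathbf{1}_{\{j=i-1\}}+p\frac{\eta(j)}{N-1}\right)[f(T_{i\to j}\eta)-f(\eta)], \] with $T_{i\to j}\eta=\eta-\mathbf{e}_i+\mathbf{e}_j$ (when $\eta(i)>0$). The process is irreducible and $\nu_N$ is its unique stationary distribution; $\operatorname{Cov}_{\nu_N}$ is the covariance when $\eta$ has law $\nu_N$. *)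

(* Defs.v *)
From HB Require Import structures.
From mathcomp Require Export all_boot all_order all_algebra.
From mathcomp Require Export all_classical all_reals all_analysis.

Set Implicit Arguments.
Unset Strict Implicit.
Unset Printing Implicit Defensive.

Import Order.TTheory GRing.Theory Num.Theory.

Local Open Scope ring_scope.

(* The sites are the elements of ['Z_K], which is the ring Z/KZ only for
   [1 < K].  Bounding each occupation number by [N] loses nothing, since they
   sum to [N], and makes the state space a [finType]. *)
Record config (K N : nat) := Config {
  occ :> {ffun 'Z_K -> 'I_N.+1};
  _ : (\sum_k occ k == N)%N }.

HB.instance Definition _ K N := [isSub for @occ K N].
HB.instance Definition _ K N := [Finite of config K N by <:].

Lemma config_point_subproof K N :
  (\sum_k [ffun k : 'Z_K => if k == 0%R then @ord_max N else ord0] k == N)%N.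
Proof.
rewrite (bigD1 (0%R : 'Z_K)) //= ffunE eqxx big1 ?addn0 //= => k /negPf k0.
by rewrite ffunE k0.
Qed.

HB.instance Definition _ K N :=
  isPointed.Build (config K N) (Config (config_point_subproof K N)).

HB.instance Definition _ K N := @isMeasurable.Build default_measure_display
  (config K N) discrete_measurable discrete_measurable0
  discrete_measurableC discrete_measurableU.

(* T_{i->j} eta = eta - e_i + e_j; the truncated subtraction and the default
   value [eta] of [insubd] only matter when [eta i = 0], where the jump rate
   vanishes (see [moveE]). *)
Definition move K N (eta : config K N) (i j : 'Z_K) : config K N :=
  insubd eta [ffun k => inord (eta k - (k == i) + (k == j))].

Lemma moveE K N (eta : config K N) (i j k : 'Z_K) : (0 < eta i)%N ->
  move eta i j k = (eta k - (k == i) + (k == j))%N :> nat.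
Proof.
move=> i_gt0.
have sumE (f : 'Z_K -> nat) : (forall k, f k = eta k - (k == i) + (k == j))%N ->
    (\sum_k f k = N)%N.
  move=> fE; have etaN : (\sum_l eta l = N)%N by case: eta {i_gt0 fE} => e /= /eqP.
  have sum1 (l : 'Z_K) : (\sum_m (m == l) = 1)%N.
    by rewrite (bigD1 l) //= eqxx big1 // => m /negPf ->.
  rewrite (eq_bigr _ (fun k _ => fE k)) big_split /= sum1 sumnB.
    by rewrite etaN sum1 subnK // -etaN (bigD1 i) //= ltn_addr.
  by move=> l _; case: eqP => // ->.
have valE l : nat_of_ord (inord (eta l - (l == i) + (l == j)) : 'I_N.+1)
    = (eta l - (l == i) + (l == j))%N.
  rewrite inordK // ltnS.
  have /esym sumN := sumE (fun m => eta m - (m == i) + (m == j))%N (fun=> erefl).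
  by rewrite [leqRHS]sumN (bigD1 l) //= leq_addr.
set g := [ffun l => inord (eta l - (l == i) + (l == j))] : {ffun 'Z_K -> 'I_N.+1}.
have gN : (\sum_l g l == N)%N by apply/eqP/sumE => l; rewrite ffunE valE.
have -> : occ (move eta i j) = g by exact: (@insubdK _ _ (config K N) eta g gN).
by rewrite ffunE valE.
Qed.

Definition generator (R : realType) K N (theta p : R)
    (f : config K N -> R) (eta : config K N) : R :=
  \sum_(i : 'Z_K) \sum_(j : 'Z_K)
    (eta i)%:R *
    ((j == i + 1)%:R + theta * (j == i - 1)%:R + p * ((eta j)%:R / (N%:R - 1))) *
    (f (move eta i j) - f eta).

Definition stationary (R : realType) K N (theta p : R)
    (nu : probability (config K N) R) : Prop :=
  forall f : config K N -> R, ('E_nu[generator theta p f] = 0)%E.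

Definition proportion (R : realType) K N (k : 'Z_K) (eta : config K N) : R :=
  (eta k)%:R / N%:R.

(* Main.v *)
Require Import Defs.
From mathcomp Require Import ring lra zify.

(** Write [a x] for the number of particles at [x], [c = p / (N - 1)], and let
    [H x y] be the stationary mean of [a x (a y - 1_{x = y})], the number of
    ordered pairs of distinct particles sitting at [x] and [y].

    The interaction copies the position of a uniformly chosen other particle,
    so it leaves the mean of [a x] alone and makes the members of a pair
    coalesce.  Hence the generator closes on functions of degree at most two.
    In degree one it is the generator of a single biased walk
    ([generator_occ]), whose harmonic functions on the cycle are constant
    ([walk_harmonic]): all sites have the same mean [m].  In degree two it is
    the generator of two independent walks, killed at rate [2 c] and with a
    source [2 p m] on the diagonal ([generator_pairs], [mean_pairs_walk]).

    Killing makes the solution of this linear system unique, by the maximum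
    principle ([killed_eq0]); the source being invariant under simultaneous
    translation of both sites, so is [H] ([mean_pairs_shift]).  Thus
    [H x y = h (y - x)], and in the difference coordinate the bias cancels: the
    two walks together perform [(1 + theta)] times the symmetric nearest
    neighbour walk, so that
    [(1 + theta) (h (d - 1) + h (d + 1) - 2 h d) = 2 c h d] for [d <> 0].
    As [h >= 0], [h] is convex on the arc from [0] to [K]; as [H] is symmetric,
    so is [h] under [d |-> K - d]; and a convex symmetric function decreases up
    to the midpoint ([convex_sym_decr]).  Finally the covariance of two
    occupation numbers is [h d + 1_{d = 0} m - m ^ 2], and the extra term only
    helps at [d = 0]. *)

Set Implicit Arguments.
Unset Strict Implicit.
Unset Printing Implicit Defensive.

Import Order.TTheory GRing.Theory Num.Theory.

Local Open Scope ring_scope.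

(** * The generator on polynomials of degree one and two *)

Definition walk (R : realType) K (theta : R) (u : 'Z_K -> R) (x : 'Z_K) : R :=
  (u (x - 1) - u x) + theta * (u (x + 1) - u x).

(** The value of [move] at an empty site is junk, but the rate vanishes there:
    increments only have to be known for occupied departure sites. *)
Lemma generatorE (R : realType) K N (theta p : R) (f : config K N -> R)
    (eta : config K N) (F : 'Z_K -> 'Z_K -> R) :
  (forall i j, (0 < eta i)%N -> f (move eta i j) - f eta = F i j) ->
  generator theta p f eta = \sum_(i : 'Z_K) \sum_(j : 'Z_K)
    (eta i)%:R * ((j == i + 1)%:R + theta * (j == i - 1)%:R +
      p * ((eta j)%:R / (N%:R - 1))) * F i j.
Proof.
move=> fF; apply: eq_bigr => i _; apply: eq_bigr => j _.
by case: (posnP (eta i)) => [->|/fF->//]; rewrite !mul0r.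
Qed.

Lemma natr_move (R : realType) K N (eta : config K N) (i j k : 'Z_K) :
  (0 < eta i)%N ->
  (move eta i j k)%:R = (eta k)%:R + ((k == j)%:R - (k == i)%:R) :> R.
Proof.
move=> i0; rewrite moveE // natrD natrB; last by case: eqP => // ->.
by rewrite addrAC addrA.
Qed.

Lemma sum_occ (R : realType) K N (eta : config K N) :
  \sum_k (eta k)%:R = N%:R :> R.
Proof. by case: eta => e /= /eqP eN; rewrite -natr_sum eN. Qed.

Lemma sum_delta (R : realType) (T : finType) (x : T) (F : T -> R) :
  \sum_i F i * (i == x)%:R = F x.
Proof.
rewrite (bigD1 x) //= eqxx mulr1 big1 ?addr0 // => i /negPf->.
by rewrite mulr0.
Qed.

(** Total rate of the jumps leaving [i], then of those arriving at [j].  Both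
    count the fictitious jumps from a site to itself, which cancel in every
    use; this is what keeps the two formulas free of exceptions. *)
Lemma sum_out (R : realType) K N (theta p : R) (eta : config K N) i :
  \sum_(j : 'Z_K) (eta i)%:R * ((j == i + 1)%:R + theta * (j == i - 1)%:R +
      p * ((eta j)%:R / (N%:R - 1)))
  = (eta i)%:R * (1 + theta + p / (N%:R - 1) * N%:R).
Proof.
have delta1 k : \sum_j (j == k)%:R = 1 :> R.
  by rewrite -[RHS](sum_delta k (fun=> 1)); apply: eq_bigr => j _;
    rewrite mul1r.
rewrite -mulr_sumr !big_split /= -!mulr_sumr -mulr_suml sum_occ !delta1; ring.
Qed.

Lemma sum_in (R : realType) K N (theta p : R) (eta : config K N) j :
  \sum_(i : 'Z_K) (eta i)%:R * ((j == i + 1)%:R + theta * (j == i - 1)%:R +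
      p * ((eta j)%:R / (N%:R - 1)))
  = (eta (j - 1))%:R + theta * (eta (j + 1))%:R +
    p / (N%:R - 1) * N%:R * (eta j)%:R.
Proof.
under eq_bigr => i _ do rewrite !mulrDr mulrCA.
rewrite !big_split /= -!mulr_suml sum_occ -mulr_sumr.
under eq_bigr => i _ do rewrite -subr_eq eq_sym.
rewrite sum_delta.
under eq_bigr => i _ do rewrite -subr_eq opprK eq_sym.
by rewrite sum_delta; congr (_ + _); ring.
Qed.

Lemma sum_flux (R : realType) (T : finType) (w : T -> T -> R) x :
  \sum_i \sum_j w i j * ((x == j)%:R - (x == i)%:R)
  = \sum_i w i x - \sum_j w x j.
Proof.
under eq_bigr => i _.
  under eq_bigr => j _ do rewrite mulrBr eq_sym.
  rewrite sumrB sum_delta -mulr_suml eq_sym; over.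
by rewrite sumrB sum_delta.
Qed.

(** Carré du champ of two occupation numbers: a jump touches both [x] and [y]
    with the same sign only if [x = y], and with opposite signs only if it goes
    from one to the other. *)
Lemma sum_flux2 (R : realType) (T : finType) (w : T -> T -> R) x y :
  \sum_i \sum_j w i j *
    (((x == j)%:R - (x == i)%:R) * ((y == j)%:R - (y == i)%:R))
  = (x == y)%:R * (\sum_i w i x + \sum_j w x j) - w x y - w y x.
Proof.
have dd z : (x == z)%:R * (y == z)%:R = (x == y)%:R * (x == z)%:R :> R.
  by case: (eqVneq x z) => [->|]; rewrite ?mulr0 ?mul0r ?mulr1 ?mul1r // eq_sym.
under eq_bigr => i _.
  under eq_bigr => j _.
    rewrite (_ : _ * _ = (x == y)%:R * (w i j * (j == x)%:R)
      + (x == y)%:R * (w i j * (i == x)%:R)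
      - (w i j * (j == y)%:R) * (i == x)%:R
      - (w i j * (j == x)%:R) * (i == y)%:R); last first.
      rewrite [j == x]eq_sym [i == x]eq_sym [j == y]eq_sym [i == y]eq_sym.
      transitivity (w i j * ((x == j)%:R * (y == j)%:R)
        + w i j * ((x == i)%:R * (y == i)%:R)
        - (w i j * (y == j)%:R) * (x == i)%:R
        - (w i j * (x == j)%:R) * (y == i)%:R); first ring.
      by rewrite !dd; ring.
    over.
  rewrite !sumrB big_split /= -!mulr_sumr -!mulr_suml !sum_delta; over.
rewrite !sumrB big_split /= -!mulr_sumr !sum_delta; ring.
Qed.

(** The interaction terms cancel: a site gains and loses particles by
    interaction at the same rate. *)
Lemma generator_occ (R : realType) K N (theta p : R) (x : 'Z_K)
    (eta : config K N) :
  generator theta p (fun eta => (eta x)%:R) eta =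
  walk theta (fun k => (eta k)%:R) x.
Proof.
rewrite (@generatorE _ _ _ _ _ _ _
  (fun i j => (x == j)%:R - (x == i)%:R)); last first.
  by move=> i j i0 /=; rewrite natr_move // addrAC subrr add0r.
rewrite sum_flux sum_in sum_out /walk; ring.
Qed.

(** The diagonal correction turns the second moment into a factorial one, which
    absorbs all the nearest-neighbour noise of the walks. *)
Definition pairs (R : realType) K N (x y : 'Z_K) (eta : config K N) : R :=
  (eta x)%:R * ((eta y)%:R - (x == y)%:R).

(** Two distinct particles walk independently; the remaining terms are the
    covariation due to the interaction, with [c = p / (N - 1)]: it is
    [- 2 c eta x eta y] for [x <> y] and [2 c eta x (N - eta x)] for [x = y]. *)
Lemma generator_pairs (R : realType) K N (theta p : R) (x y : 'Z_K)
    (eta : config K N) : (2 <= N)%N ->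
  generator theta p (@pairs R K N x y) eta =
  walk theta (fun z => pairs R x z eta) y
  + walk theta (fun z => pairs R z y eta) x
  - 2 * (p / (N%:R - 1)) * pairs R x y eta + 2 * p * (x == y)%:R * (eta x)%:R.
Proof.
move=> N2.
have N1 : N%:R - 1 != 0 :> R.
  by rewrite subr_eq0 pnatr_eq1; case: N N2 {eta} => [|[]].
(* [d k i j] is the increment of [eta k] in a jump from [i] to [j] *)
pose d (k i j : 'Z_K) : R := (k == j)%:R - (k == i)%:R.
rewrite (@generatorE _ _ _ _ _ _ _ (fun i j =>
  d x i j * ((eta y)%:R - (x == y)%:R) + d y i j * (eta x)%:R
  + d x i j * d y i j)); last first.
  by move=> i j i0; rewrite /pairs !natr_move // -/(d x i j) -/(d y i j); ring.
pose w (i j : 'Z_K) : R := (eta i)%:R *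
  ((j == i + 1)%:R + theta * (j == i - 1)%:R + p * ((eta j)%:R / (N%:R - 1))).
transitivity ((\sum_i \sum_j w i j * d x i j) * ((eta y)%:R - (x == y)%:R)
  + (\sum_i \sum_j w i j * d y i j) * (eta x)%:R
  + \sum_i \sum_j w i j * (d x i j * d y i j)).
  rewrite !mulr_suml -!big_split; apply: eq_bigr => i _ /=.
  rewrite !mulr_suml -!big_split; apply: eq_bigr => j _ /=.
  by rewrite -/(w i j); ring.
rewrite !sum_flux sum_flux2 !sum_in !sum_out /w /walk /pairs.
have e1 : (y == x + 1) = (x == y - 1) by rewrite -subr_eq eq_sym.
have e2 : (y == x - 1) = (x == y + 1) by rewrite -subr_eq opprK eq_sym.
have f1 : (x - 1 == y) = (x == y + 1) by rewrite subr_eq.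
have f2 : (x + 1 == y) = (x == y - 1) by rewrite -(subr_eq x _ (-1)) opprK.
rewrite e1 e2 f1 f2.
(* a neighbour of [x] that coincides with [y] has the occupation number of [y]:
   this matches the walk terms of the generator with those of [pairs] *)
have g1 : (eta (x - 1))%:R * (x == y + 1)%:R
    = (eta y)%:R * (x == y + 1)%:R :> R.
  by case: eqP => [->|]; rewrite ?mulr0 ?addrK.
have g2 : (eta (x + 1))%:R * (x == y - 1)%:R
    = (eta y)%:R * (x == y - 1)%:R :> R.
  by case: eqP => [->|]; rewrite ?mulr0 ?subrK.
set c := p / _.
have pc : p = c * (N%:R - 1) by rewrite /c divfK.
have cE k : p * ((eta k)%:R / (N%:R - 1)) = c * (eta k)%:R :> R.
  by rewrite /c; ring.
rewrite !cE; have [xy|xy] := eqVneq x y.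
  by rewrite -xy in g1 g2 *; ring: g1 g2 pc.
by ring: g1 g2 pc.
Qed.

(** * Expectations on the finite configuration space *)

Lemma Lfun1_config (R : realType) K N (nu : probability (config K N) R)
    (f : config K N -> R) : f \in Lfun nu 1.
Proof.
apply/Lfun1_integrable; apply: measurable_bounded_integrable => //.
  exact: le_lt_trans (probability_le1 nu measurableT) (ltry 1).
exists (\sum_e `|f e|); split; first exact: num_real.
move=> M /ltW fM e _; apply: le_trans fM; rewrite (bigD1 e) //= lerDl.
exact: sumr_ge0.
Qed.

Definition mean (R : realType) K N (nu : probability (config K N) R)
  (f : config K N -> R) : R := fine 'E_nu[f]%E.

Lemma meanE (R : realType) K N (nu : probability (config K N) R) f :
  ('E_nu[f] = (mean nu f)%:E)%E.
Proof. by rewrite fineK // expectation_fin_num // Lfun1_config. Qed.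

Lemma meanD (R : realType) K N (nu : probability (config K N) R) f g :
  mean nu (fun e => f e + g e) = mean nu f + mean nu g.
Proof.
by apply: EFin_inj; rewrite EFinD -!meanE -expectationD ?Lfun1_config.
Qed.

Lemma meanZ (R : realType) K N (nu : probability (config K N) R) a f :
  mean nu (fun e => a * f e) = a * mean nu f.
Proof.
apply: EFin_inj; rewrite EFinM -!meanE -expectationZl ?Lfun1_config //.
by congr ('E_nu[_]%E); apply/funext => e /=; rewrite mulrC.
Qed.

Lemma meanB (R : realType) K N (nu : probability (config K N) R) f g :
  mean nu (fun e => f e - g e) = mean nu f - mean nu g.
Proof.
by apply: EFin_inj; rewrite EFinB -!meanE -expectationB ?Lfun1_config.
Qed.

Lemma mean_ge0 (R : realType) K N (nu : probability (config K N) R) f :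
  (forall e, 0 <= f e) -> 0 <= mean nu f.
Proof. by move=> f0; rewrite -lee_fin -meanE expectation_ge0. Qed.

Lemma mean_generator (R : realType) K N (theta p : R)
    (nu : probability (config K N) R) f :
  stationary theta p nu -> mean nu (generator theta p f) = 0.
Proof. by move=> st; apply: EFin_inj; rewrite -meanE st. Qed.

Lemma mean_walk (R : realType) K N (nu : probability (config K N) R)
    theta (F : 'Z_K -> config K N -> R) x :
  mean nu (fun e => walk theta (F^~ e) x)
  = walk theta (fun z => mean nu (F z)) x.
Proof. by rewrite /walk meanD meanZ !meanB. Qed.

(** * Harmonic and killed functions of the walk, convex sequences *)

(** The uniform measure is invariant for the walk, so the sum of
    [u x * walk theta u x] is minus [(1 + theta) / 2] times the Dirichlet energy
    of [u], which must vanish. *)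
Lemma walk_harmonic (R : realType) K (theta : R) (u : 'Z_K -> R) :
  0 < theta -> (forall x, walk theta u x = 0) -> forall x, u x = u 0.
Proof.
move=> th0 wu.
have shift (F : 'Z_K -> R) : \sum_x F (x + 1) = \sum_x F x.
  by rewrite [RHS](reindex_inj (addIr 1)).
have e0 : \sum_x (u (x + 1) - u x) ^+ 2 = 0.
  have : (1 + theta) * \sum_x (u (x + 1) - u x) ^+ 2 = 0; last first.
    by move/eqP; rewrite mulf_eq0 => /orP[|/eqP//]; rewrite gt_eqF // addr_gt0.
  transitivity (- 2 * \sum_x u x * walk theta u x); last first.
    by under eq_bigr => x _ do rewrite wu mulr0; rewrite big1 ?mulr0.
  pose A := \sum_x u x ^+ 2; pose B := \sum_x u x * u (x + 1).
  have -> : \sum_x (u (x + 1) - u x) ^+ 2 = 2 * (A - B).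
    transitivity (A + \sum_x u (x + 1) ^+ 2 - 2 * B).
      rewrite /A /B mulr_sumr -big_split -sumrB; apply: eq_bigr => x _ /=; ring.
    by rewrite (shift (fun x => u x ^+ 2)) -/A; ring.
  have -> : \sum_x u x * walk theta u x = (1 + theta) * (B - A).
    transitivity (\sum_x u x * u (x - 1) + theta * B - (1 + theta) * A).
      rewrite /A /B !mulr_sumr -big_split -sumrB; apply: eq_bigr => x _ /=.
      rewrite /walk; ring.
    rewrite -(shift (fun x => u x * u (x - 1))).
    under eq_bigr => x _ do rewrite addrK mulrC.
    rewrite -/B; ring.
  ring.
have step x : u (x + 1) = u x.
  apply/eqP; rewrite -subr_eq0 -sqrf_eq0.
  by move/psumr_eq0P: e0 => -> // y _; rewrite sqr_ge0.
move=> x; rewrite -[x]natr_Zp; elim: (x : nat) => // n IH.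
by rewrite -addn1 natrD step.
Qed.

(** At a point where [D] is maximal every increment is nonpositive, so the
    equation forces [c * D <= 0] there. *)
Lemma killed_le0 (R : realType) K (theta c : R) (D : 'Z_K -> 'Z_K -> R) :
  0 < theta -> 0 < c ->
  (forall x y, walk theta (D x) y + walk theta (D^~ y) x = c * D x y) ->
  forall x y, D x y <= 0.
Proof.
move=> th0 c0 DE x y.
pose m := [arg max_(z > (x, y)) D z.1 z.2]%O.
have mP a b : D a b <= D m.1 m.2.
  by rewrite /m; case: arg_maxP => // z _ /(_ (a, b) isT).
apply: le_trans (mP x y) _; rewrite -(pmulr_rle0 _ c0) -DE /walk.
have mono a b : (D a b - D m.1 m.2) <= 0 by rewrite subr_le0.
have mono' a b : theta * (D a b - D m.1 m.2) <= 0 by rewrite pmulr_rle0.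
move: (mono m.1 (m.2 - 1)) (mono' m.1 (m.2 + 1)).
move: (mono (m.1 - 1) m.2) (mono' (m.1 + 1) m.2); lra.
Qed.

Lemma killed_eq0 (R : realType) K (theta c : R) (D : 'Z_K -> 'Z_K -> R) :
  0 < theta -> 0 < c ->
  (forall x y, walk theta (D x) y + walk theta (D^~ y) x = c * D x y) ->
  forall x y, D x y = 0.
Proof.
move=> th0 c0 DE x y; apply/eqP; rewrite eq_le (killed_le0 th0 c0 DE) /=.
rewrite -oppr_le0.
apply: (killed_le0 (D := fun x y => - D x y) th0 c0) => {x y} x y /=.
by rewrite mulrN -DE /walk; ring.
Qed.

(** The increments of [a] increase by convexity, and symmetry makes the
    increment at [K - 1 - k] the opposite of the one at [k]; since
    [k <= K - 1 - k], the increment at [k] is at most its own opposite. *)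
Lemma convex_sym_decr (R : realType) (K : nat) (a : nat -> R) :
  (forall n, (n <= K)%N -> a (K - n)%N = a n) ->
  (forall n, (0 < n < K)%N -> 2 * a n <= a n.-1 + a n.+1) ->
  forall k, (k < K./2)%N -> a k.+1 <= a k.
Proof.
move=> sym cvx k kK.
have incr i j : (i + j < K)%N -> a i.+1 - a i <= a (i + j).+1 - a (i + j)%N.
  elim: j => [|j IH] ij; first by rewrite addn0.
  apply: le_trans (IH _) _; first lia.
  have := cvx (i + j).+1; rewrite addnS /= => /(_ ltac:(lia)); lra.
have := incr k (K.-1 - k.*2)%N ltac:(lia).
rewrite (_ : (k + _).+1 = K - k)%N; last lia.
rewrite (_ : (k + (K.-1 - _)) = K - k.+1)%N; last lia.
rewrite !sym; [lra|lia|lia].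
Qed.

(** * First and second moments under a stationary law *)

Lemma mean_occ (R : realType) K N (theta p : R)
    (nu : probability (config K N) R) : 0 < theta -> stationary theta p nu ->
  forall x, mean nu (fun e => (e x)%:R) = mean nu (fun e => (e 0)%:R).
Proof.
move=> th0 st; apply: (walk_harmonic th0) => x.
rewrite -(mean_walk nu theta (fun z e => (e z)%:R)).
rewrite -(mean_generator (fun e : config K N => (e x)%:R) st).
by congr (mean nu _); apply/funext => e; rewrite generator_occ.
Qed.

(** The source on the diagonal is the same at every site because all sites have
    the same mean occupation number. *)
Lemma mean_pairs_walk (R : realType) K N (theta p : R)
    (nu : probability (config K N) R) : (2 <= N)%N -> 0 < theta ->
  stationary theta p nu -> forall x y,
  let H x y := mean nu (pairs R x y) in
  walk theta (H x) y + walk theta (H^~ y) x =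
  2 * (p / (N%:R - 1)) * H x y
  - 2 * p * (x == y)%:R * mean nu (fun e => (e 0)%:R).
Proof.
move=> N2 th0 st x y H.
have := mean_generator (pairs R x y) st.
rewrite [generator _ _ _](_ : _ = fun e => walk theta (fun z => pairs R x z e) y
  + walk theta (fun z => pairs R z y e) x - 2 * (p / (N%:R - 1)) * pairs R x y e
  + 2 * p * (x == y)%:R * (e x)%:R); last first.
  by apply/funext => e; rewrite generator_pairs.
rewrite meanD meanB meanD !meanZ (mean_occ th0 st).
rewrite (mean_walk nu theta (fun z => pairs R x z)).
rewrite (mean_walk nu theta (fun z => pairs R z y)) -/(H x y) -/(H x).
move=> e; apply/eqP; rewrite -subr_eq0 -e; apply/eqP; rewrite /walk /H; ring.
Qed.

(** The source [1_{x = y}] does not see a common translation, so the difference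
    of the two sides solves the killed equation without source. *)
Lemma mean_pairs_shift (R : realType) K N (theta p : R)
    (nu : probability (config K N) R) : (2 <= N)%N -> 0 < theta -> 0 < p ->
  stationary theta p nu ->
  forall x y, mean nu (pairs R (x + 1) (y + 1)) = mean nu (pairs R x y).
Proof.
move=> N2 th0 p0 st x y.
have c0 : 0 < 2 * (p / (N%:R - 1)) :> R.
  by rewrite mulr_gt0 // divr_gt0 // subr_gt0 (ltr_nat _ 1).
pose D x y := mean nu (pairs R (x + 1) (y + 1)) - mean nu (pairs R x y).
apply/eqP; rewrite -subr_eq0; apply/eqP.
apply: (killed_eq0 (D := D) th0 c0) => {x y} x y.
have := mean_pairs_walk N2 th0 st (x + 1) (y + 1).
have := mean_pairs_walk N2 th0 st x y.
rewrite /= (inj_eq (addIr _)) /walk /D !(addrAC _ 1 (-1)) ?(addrAC _ (-1) 1).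
lra.
Qed.

Lemma mean_pairs_translate (R : realType) K N (theta p : R)
    (nu : probability (config K N) R) : (2 <= N)%N -> 0 < theta -> 0 < p ->
  stationary theta p nu ->
  forall x y z, mean nu (pairs R (x + z) (y + z)) = mean nu (pairs R x y).
Proof.
move=> N2 th0 p0 st x y z; rewrite -[z]natr_Zp.
elim: (z : nat) => [|n IH]; first by rewrite !addr0.
by rewrite -natr1 !addrA (mean_pairs_shift N2 th0 p0 st).
Qed.

Lemma natr_Zp_neq0 K n : (2 <= K)%N -> (0 < n)%N -> (n < K)%N ->
  n%:R != 0 :> 'Z_K.
Proof.
by move=> K2 n0 nK; rewrite -val_eqE /= val_Zp_nat // modn_small -?lt0n.
Qed.

(** Translation invariance turns the equation for pairs into one in the
    difference of the sites, where drift cancels and only convexity is left. *)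
Lemma mean_pairs_decr (R : realType) K N (theta p : R)
    (nu : probability (config K N) R) : (2 <= K)%N -> (2 <= N)%N ->
  0 < theta -> 0 < p -> stationary theta p nu ->
  forall k : nat, (k < K./2)%N ->
  mean nu (pairs R (0 : 'Z_K) k.+1%:R) <= mean nu (pairs R (0 : 'Z_K) k%:R).
Proof.
move=> K2 N2 th0 p0 st.
have shift := mean_pairs_translate N2 th0 p0 st.
have K0 : K%:R = 0 :> 'Z_K by rewrite pchar_Zp.
apply: (@convex_sym_decr _ K (fun k => mean nu (pairs R (0 : 'Z_K) k%:R))).
  move=> n nK; rewrite natrB // K0 sub0r -(shift _ _ n%:R) add0r addNr.
  congr (mean nu _); apply/funext => e; rewrite /pairs eq_sym.
  by case: eqP => [->//|_]; rewrite !subr0 mulrC.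
case=> // n /= nK.
have n0 := natr_Zp_neq0 K2 (ltn0Sn n) nK.
have := mean_pairs_walk N2 th0 st 0 n.+1%:R.
rewrite /= eq_sym (negPf n0) mulr0 mul0r subr0 /walk.
(* a move of the particle at [0] is an opposite move of the other one *)
rewrite -(shift (0 - 1) n.+1%:R 1) -(shift (0 + 1) n.+1%:R (- 1)).
have predn : n.+1%:R - 1 = n%:R :> 'Z_K by rewrite -natr1 addrK.
rewrite addrK subrK predn natr1.
have : 0 <= mean nu (pairs R (0 : 'Z_K) n.+1%:R).
  by apply: mean_ge0 => e; rewrite /pairs eq_sym (negPf n0) subr0 mulr_ge0.
set A := mean _ (pairs R 0 n%:R); set B := mean _ (pairs R 0 n.+1%:R).
set C := mean _ _ => B0 eqB.
have c0 : 0 <= 2 * (p / (N%:R - 1)) :> R.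
  by rewrite mulr_ge0 // divr_ge0 ?ltW // subr_gt0 (ltr_nat _ 1).
rewrite -subr_ge0 -(@pmulr_rge0 _ (1 + theta)); last by rewrite addr_gt0.
suff -> : (1 + theta) * (A + C - 2 * B) = 2 * (p / (N%:R - 1)) * B.
  exact: mulr_ge0.
by rewrite -eqB; ring.
Qed.

Lemma covariance_proportion (R : realType) K N (theta p : R)
    (nu : probability (config K N) R) : 0 < theta -> stationary theta p nu ->
  forall x y : 'Z_K,
  let m := mean nu (fun e => (e 0)%:R) in
  covariance nu (@proportion R K N x) (@proportion R K N y) =
  ((mean nu (pairs R x y) + (x == y)%:R * m - m ^+ 2) / N%:R ^+ 2)%:E.
Proof.
move=> th0 st x y m.
have mprop z : mean nu (@proportion R K N z) = N%:R^-1 * m.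
  rewrite /m -(mean_occ th0 st z) -meanZ.
  by congr (mean nu _); apply/funext => e; rewrite /proportion mulrC.
rewrite covarianceE ?Lfun1_config // !meanE !mprop -EFinM -EFinB.
have -> : (proportion R x : config K N -> R) * proportion R y =
    (fun e => (N%:R ^+ 2)^-1 * (pairs R x y e + (x == y)%:R * (e x)%:R)).
  apply/funext => e; rewrite /proportion /pairs /= -exprVn.
  by rewrite [LHS](_ : _ = (e x)%:R / N%:R * ((e y)%:R / N%:R)) //; ring.
rewrite meanZ meanD meanZ (mean_occ th0 st) -/m -!exprVn; congr EFin.
by clearbody m; ring.
Qed.

Theorem corollary1p5 (R : realType) (K N : nat) (theta p : R)
    (nu : probability (config K N) R) :
  (3 <= K)%N -> (2 <= N)%N -> 0 < theta -> 0 < p ->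
  stationary theta p nu ->
  forall k : nat, (k < K./2)%N ->
    (covariance nu (@proportion R K N 0%R) (@proportion R K N k.+1%:R%R)
      <= covariance nu (@proportion R K N 0%R) (@proportion R K N k%:R%R))%E.
Proof.
move=> K3 N2 th0 p0 st k kK.
have K2 : (2 <= K)%N by exact: ltnW.
rewrite !(covariance_proportion th0 st) lee_fin ler_pM2r; last first.
  by rewrite invr_gt0 exprn_gt0 // ltr0n ltnW.
have k1 := natr_Zp_neq0 K2 (ltn0Sn k) ltac:(lia).
rewrite lerD2r [0 == k.+1%:R]eq_sym (negPf k1) mul0r addr0.
apply: le_trans (mean_pairs_decr K2 N2 th0 p0 st kK) _.
by rewrite lerDl mulr_ge0 // mean_ge0.
Qed.
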